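(* Let $G$ and $H$ be two graphs of order $n$. Suppose that $\alpha(G)\le \alpha(H)$ and $$\frac{i_k(G)}{i_{k-1}(G)} \le \frac{i_k(H)}{i_{k-1}(H)}\qquad\text{for every } 1\le k\le \alpha(G).$$ Then $\alpha_G(\lambda)\le \alpha_H(\lambda)$ for every real $\lambda\ge 0$.
   Context: Graphs are finite and simple; the order of a graph is its number of vertices. For a graph $G$, $\alpha(G)$ denotes the independence number (the number of vertices in a maximum independent set), and $i_k(G)$ denotes the number of independent sets of $G$ with exactly $k$ vertices (so $i_0(G)=1$). The partition function of $G$ is $P_G(\lambda)=\sum_{k=0}^{\alpha(G)} i_k(G)\lambda^k$, and the occupancy fraction of $G$ at fugacity $\lambda$ is $\alpha_G(\lambda)=\frac{\lambda P_G'(\lambda)}{|V(G)|\,P_G(\lambda)}$ (not to be confused with the independence number $\alpha(G)$). *)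

(* Defs.v *)
From mathcomp Require Import all_boot all_order all_algebra.
From mathcomp Require Import reals.

Set Implicit Arguments.
Unset Strict Implicit.
Unset Printing Implicit Defensive.

Import Order.TTheory GRing.Theory Num.Theory.

Local Open Scope ring_scope.

Record sgraph := SGraph {
  vertex :> finType;
  adj : rel vertex;
  adj_sym : symmetric adj;
  adj_irrefl : irreflexive adj }.

Definition independent (G : sgraph) (S : {set G}) : bool :=
  [forall x in S, forall y in S, ~~ adj x y].

Definition indep_number (G : sgraph) : nat :=
  \max_(S : {set G} | independent S) #|S|.

Definition indep_count (G : sgraph) (k : nat) : nat :=
  #|[set S : {set G} | independent S & #|S| == k]|.

Definition partition_function (R : realType) (G : sgraph) : {poly R} :=
  \sum_(0 <= k < (indep_number G).+1) (indep_count G k)%:R *: 'X^k.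

(* Since x / 0 = 0, this is 0 for the graph with no vertices. *)
Definition occupancy_fraction (R : realType) (G : sgraph) (lambda : R) : R :=
  lambda * (partition_function R G)^`().[lambda]
  / (#|G|%:R * (partition_function R G).[lambda]).

(* Main.v *)
(* Write N_G = lambda P_G'. The ratio condition telescopes to
   i_k(G) i_j(H) <= i_j(G) i_k(H) for j <= k. Exchanging the summation indices
   in N_H P_G - N_G P_H and averaging turns it into half the sum of
   (k - j) (i_k(H) i_j(G) - i_k(G) i_j(H)) lambda^(k + j), whose terms are all
   nonnegative. *)

Require Import Defs.
From mathcomp Require Import all_boot all_order all_algebra.
From mathcomp Require Import reals.
From mathcomp Require Import ring.

Set Implicit Arguments.
Unset Strict Implicit.
Unset Printing Implicit Defensive.

Import Order.TTheory GRing.Theory Num.Theory.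

Local Open Scope ring_scope.

Lemma ler_sum_cross (R : realFieldType) (a b : nat -> R) (x : R) (m : nat) :
    0 <= x -> (forall j k, (j <= k)%N -> a k * b j <= a j * b k) ->
  (\sum_(k < m) k%:R * a k * x ^+ k) * (\sum_(j < m) b j * x ^+ j) <=
  (\sum_(k < m) k%:R * b k * x ^+ k) * (\sum_(j < m) a j * x ^+ j).
Proof.
move=> x_ge0 cross; rewrite -subr_ge0 !mulr_suml -sumrB.
under eq_bigr => k _ do rewrite !mulr_sumr -sumrB.
set D := (X in 0 <= X).
(* [D] is doubled and the indices are exchanged in one copy only, so that the terms at [(k, j)] and
   [(j, k)] are added together. *)
rewrite -(pmulr_rge0 D (ltr0n R 2)) mulr_natl mulr2n {2}/D exchange_big /=.
rewrite /D -big_split /=; apply: sumr_ge0 => k _.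
rewrite -big_split /=; apply: sumr_ge0 => j _.
have -> : k%:R * b k * x ^+ k * (a j * x ^+ j) -
    k%:R * a k * x ^+ k * (b j * x ^+ j) +
    (j%:R * b j * x ^+ j * (a k * x ^+ k) -
     j%:R * a j * x ^+ j * (b k * x ^+ k)) =
    (k%:R - j%:R) * (a j * b k - a k * b j) * (x ^+ k * x ^+ j) :> R by ring.
apply: mulr_ge0; last by rewrite mulr_ge0 ?exprn_ge0.
(* The factors [k%:R - j%:R] and [a j * b k - a k * b j] have the same sign: both nonnegative if
   [j <= k], both nonpositive otherwise. *)
have [le_jk | /ltnW le_kj] := leqP j k.
  by rewrite mulr_ge0 ?subr_ge0 ?ler_nat ?cross.
by rewrite mulr_le0 ?subr_le0 ?ler_nat ?cross.
Qed.

(** Induction on [k], one ratio inequality per step. Beyond [A] the left side vanishes. *)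
Lemma ratio_cross (R : realFieldType) (a b : nat -> R) (A : nat) :
    (forall k, 0 <= b k) -> (forall k, (k <= A)%N -> 0 < a k) ->
    (forall k, (A < k)%N -> a k = 0) ->
    (forall k, (1 <= k <= A)%N -> a k / a k.-1 <= b k / b k.-1) ->
  forall j k, (j <= k)%N -> a k * b j <= a j * b k.
Proof.
move=> b_ge0 a_gt0 a_eq0 le_ab j.
have a_ge0 i : 0 <= a i by case: (leqP i A) => [/a_gt0/ltW | /a_eq0->].
elim=> [|k IHk].
  by rewrite leqn0 => /eqP->.
rewrite leq_eqVlt => /predU1P[-> // | /IHk le_k].
have [lt_kA | lt_Ak] := leqP k.+1 A; last first.
  by rewrite a_eq0 // mul0r mulr_ge0.
have ak_gt0 : 0 < a k by rewrite a_gt0 // ltnW.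
have ak1_gt0 := a_gt0 _ lt_kA.
have /= le_ratio := le_ab k.+1 lt_kA.
(* If [b k] were 0, the right-hand ratio would be 0 by the convention [x / 0 = 0], while the
   left-hand one is positive. *)
have bk_gt0 : 0 < b k.
  rewrite lt_def b_ge0 andbT; apply: contraTneq le_ratio => ->.
  by rewrite invr0 mulr0 -ltNge divr_gt0.
move: le_ratio; rewrite ler_pdivrMr // mulrAC ler_pdivlMr // => le_k1.
(* After scaling by [a k > 0], the chain is [a k * a k.+1 * b j <= a k.+1 * a j * b k <= a j * a k *
   b k.+1]. *)
rewrite -(ler_pM2l ak_gt0) mulrCA.
apply: le_trans (ler_wpM2l (ltW ak1_gt0) le_k) _.
by rewrite mulrCA [leRHS]mulrCA ler_wpM2l // [leRHS]mulrC.
Qed.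

(** Every subset of a maximum independent set is independent; the witness consists of the first [k]
    elements of such a set. *)
Lemma indep_count_gt0 (G : sgraph) (k : nat) :
  (k <= indep_number G)%N -> (0 < indep_count G k)%N.
Proof.
have indep0 : independent (set0 : {set G}).
  by apply/forall_inP => x; rewrite inE.
have ex_indep : (0 < #|@independent G|)%N by apply/card_gt0P; exists set0.
have [S indepS cardS] := eq_bigmax_cond (fun S : {set G} => #|S|) ex_indep.
rewrite /indep_number cardS cardE => le_k.
apply/card_gt0P; exists [set x in take k (enum S)]; rewrite inE; apply/andP; split.
  have subS x : x \in [set x in take k (enum S)] -> x \in S.
    by rewrite inE => /mem_take; rewrite mem_enum.
  apply/forall_inP => x /subS Sx; apply/forall_inP => y /subS Sy.
  by move/forall_inP: indepS => /(_ x Sx)/forall_inP/(_ y Sy).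
by rewrite cardsE (card_uniqP _) ?take_uniq ?enum_uniq // size_takel.
Qed.

Lemma indep_count_eq0 (G : sgraph) (k : nat) :
  (indep_number G < k)%N -> indep_count G k = 0%N.
Proof.
move=> lt_k; apply/eqP; rewrite cards_eq0; apply/eqP/setP=> S; rewrite !inE.
apply: contraTF lt_k => /andP[indepS /eqP <-]; rewrite -leqNgt.
by rewrite /indep_number leq_bigmax_cond.
Qed.

(** The added coefficients vanish. This puts the sums for both graphs over one range, as
    [ler_sum_cross] requires. *)
Lemma partition_function_widen (R : realType) (G : sgraph) (m : nat) :
    (indep_number G < m)%N ->
  partition_function R G = \sum_(k < m) (indep_count G k)%:R *: 'X^k.
Proof.
move=> lt_m; rewrite -(big_mkord xpredT (fun k => (indep_count G k)%:R *: 'X^k)).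
rewrite (big_cat_nat _ lt_m) //= [X in _ + X]big_nat [X in _ + X]big1 ?addr0 // => k.
by case/andP=> lt_k _; rewrite indep_count_eq0 // scale0r.
Qed.

Lemma horner_partition_function (R : realType) (G : sgraph) (m : nat) (x : R) :
    (indep_number G < m)%N ->
  (partition_function R G).[x] = \sum_(k < m) (indep_count G k)%:R * x ^+ k.
Proof.
move=> lt_m; rewrite (partition_function_widen R lt_m) horner_sum.
by apply: eq_bigr => k _; rewrite hornerZ hornerXn.
Qed.

Lemma horner_deriv_partition_function (R : realType) (G : sgraph) (m : nat)
    (x : R) :
    (indep_number G < m)%N ->
  x * (partition_function R G)^`().[x] =
    \sum_(k < m) k%:R * (indep_count G k)%:R * x ^+ k.
Proof.
move=> lt_m; rewrite (partition_function_widen R lt_m) raddf_sum horner_sum.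
(* The factor [x] restores the exponent lowered by differentiation, except at index 0, where both
   sides are 0. *)
rewrite mulr_sumr; apply: eq_bigr => -[[|k] lt_k] _ /=.
  by rewrite derivZ derivXn mulr0n scaler0 horner0 mulr0 !mul0r.
rewrite derivZ derivXn hornerZ hornerMn hornerXn /= exprS -mulr_natl; ring.
Qed.

Lemma partition_function_gt0 (R : realType) (G : sgraph) (x : R) :
  0 <= x -> 0 < (partition_function R G).[x].
Proof.
move=> x_ge0; rewrite (horner_partition_function _ (ltnSn _)) big_ord_recl.
rewrite ltr_pwDl ?mulr1 ?ltr0n ?indep_count_gt0 //.
by apply: sumr_ge0 => k _; rewrite mulr_ge0 ?exprn_ge0.
Qed.

Theorem proposition4p1 (R : realType) (n : nat) (G H : sgraph)
  (orderG : #|G| = n) (orderH : #|H| = n)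
  (le_alpha : (indep_number G <= indep_number H)%N)
  (le_ratio : forall k : nat, (1 <= k <= indep_number G)%N ->
     (indep_count G k)%:R / (indep_count G k.-1)%:R
       <= (indep_count H k)%:R / (indep_count H k.-1)%:R :> R) :
  forall lambda : R, 0 <= lambda ->
    occupancy_fraction G lambda <= occupancy_fraction H lambda.
Proof.
move=> x x_ge0; rewrite /occupancy_fraction orderG orderH.
(* By [le_alpha] this range covers the independent sets of both graphs. *)
set m := (indep_number H).+1.
have lt_G : (indep_number G < m)%N by [].
have PG_gt0 := partition_function_gt0 G x_ge0.
have PH_gt0 := partition_function_gt0 H x_ge0.
(* The common factor [n%:R^-1] is removed using only that it is nonnegative, which includes
   [n = 0]. *)
rewrite !invfM !(mulrCA _ n%:R^-1) ler_wpM2l ?invr_ge0 //.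
rewrite ler_pdivrMr // mulrAC ler_pdivlMr //.
rewrite !(horner_deriv_partition_function _ lt_G).
rewrite !(horner_deriv_partition_function _ (ltnSn (indep_number H))).
rewrite !(horner_partition_function _ lt_G).
rewrite !(horner_partition_function _ (ltnSn (indep_number H))).
apply: (ler_sum_cross (a := fun k => (indep_count G k)%:R)
                      (b := fun k => (indep_count H k)%:R)) => //.
apply: (ratio_cross (A := indep_number G)) => // k.
- by rewrite ltr0n; apply: indep_count_gt0.
- by move/indep_count_eq0->.
Qed.
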